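(* Let $T>0$, let $\sigma(x_t,\gamma(t))$ be the semi-Markov stochastic volatility described in the context, with $(x_0,\gamma(0))=(x,0)$, and let $$\sigma_R^2(x)=\frac1T\int_0^T\sigma^2(x_s,\gamma(s))\,ds$$ be the realized variance. Then the value of the volatility swap, $P_{vol}(x)=\mathbb{E}\{e^{-rT}(\sqrt{\sigma_R^2(x)}-K_{vol})\}$, is given by $$P_{vol}(x)\approx e^{-rT}\left\{\sqrt{\frac1T\int_0^T e^{tQ}\sigma^2(x,0)\,dt}-\frac{\mathrm{Var}\{\sigma_R^2(x)\}}{8\left(\frac1T\int_0^T e^{tQ}\sigma^2(x,0)\,dt\right)^{3/2}}-K_{vol}\right\},$$ where $\approx$ means that $\mathbb{E}\{\sqrt{\sigma_R^2(x)}\}$ has been replaced by its second-order Taylor approximation $\sqrt{\mathbb{E}\{\sigma_R^2(x)\}}-\frac{\mathrm{Var}\{\sigma_R^2(x)\}}{8\,\mathbb{E}\{\sigma_R^2(x)\}^{3/2}}$; that is, the right-hand side of the displayed formula for $P_{vol}(x)$ is exactly equal to $$e^{-rT}\left\{\sqrt{\mathbb{E}\{\sigma_R^2(x)\}}-\frac{\mathrm{Var}\{\sigma_R^2(x)\}}{8\,\mathbb{E}\{\sigma_R^2(x)\}^{3/2}}-K_{vol}\right\}.$$ Moreover, the variance is given (exactly) by $$\mathrm{Var}\{\sigma_R^2(x)\}=\frac{2}{T^2}\int_0^T\int_0^t\left\{e^{sQ}\left[\sigma^2(x,0)\,e^{(t-s)Q}\sigma^2(x,0)\right]-\left[e^{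tQ}\sigma^2(x,0)\right]\left[e^{sQ}\sigma^2(x,0)\right]\right\}ds\,dt.$$
   Context: Semi-Markov process. Let $(X,\mathscr{X})$ be a measurable space and $Q_{SM}(x,B,t)=P(x,B)G_x(t)$ ($x\in X$, $B\in\mathscr{X}$, $t\ge 0$) a semi-Markov kernel, where $P$ is a transition probability kernel on $X$ and $G_x$ is a distribution function on $\mathbb{R}_+$ with density $g_x(t)=\frac{dG_x(t)}{dt}$; write $\overline{G}_x(t)=1-G_x(t)$. Let $(x_n,\tau_n)_{n\in\mathbb{N}}$ be a Markov renewal process with this kernel, i.e. $\mathbb{P}(x_{n+1}\in B,\tau_{n+1}-\tau_n\le t\mid\mathscr{F}_n)=Q_{SM}(x_n,B,t)$. Put $\nu(t)=\sup\{n:\tau_n\le t\}$, $x_t=x_{\nu(t)}$ (the semi-Markov process) and $\gamma(t)=t-\tau_{\nu(t)}$ (the backward recurrence time). The pair $(x_t,\gamma(t))_{t\ge0}$ is a Markov process on $X\times\mathbb{R}_+$ with generator $$Qf(x,t)=\frac{df}{dt}(x,t)+\frac{g_x(t)}{\overline{G}_x(t)}\int_X P(x,dy)\,[f(y,0)-f(x,t)].$$ The process starts at $(x_0,\gamma(0))=(x,0)$, and $\mathscr{F}_t$ is the filtration generated by $(x_s,\gamma(s))_{s\le t}$. Notation. $(e^{tQ})_{t\ge0}$ is the operator semigroup generated by $Q$, acting on functions on $X\times\mathbb{R}_+$; $e^{tQ}f(x,0)$ means $(e^{tQ}f)(x,0)$, and $e^{sQ}[\sigma^2(x,0)\,e^{(t-s)Q}\sigma^2(x,0)]$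 means the operator $e^{sQ}$ applied to the product function $\sigma^2\cdot(e^{(t-s)Q}\sigma^2)$, evaluated at $(x,0)$. Market. The stock satisfies $dS_t=S_t(r\,dt+\sigma(x_t,\gamma(t))\,dw_t)$, where $r$ is the risk-free rate, $\sigma$ is a function on $X\times\mathbb{R}_+$ and $w$ is a standard Wiener process independent of $(x,\gamma)$. $\mathbb{E}$ and $\mathrm{Var}$ are taken in the risk-neutral world (minimal martingale measure), under which $(x_t,\gamma(t))_{t\ge0}$ is a Markov process on $X\times\mathbb{R}_+$ with generator $Q$ started at $(x,0)$. $K_{vol}$ is a constant (the strike); the notional amount is $1$. The function $\sigma$ is understood to be such that the displayed expressions are well defined (in particular $\mathbb{E}\{\sigma_R^2(x)\}>0$). *)

(* Defs.v *)
From HB Require Import structures.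
From mathcomp Require Import all_boot all_order all_algebra.
From mathcomp Require Import all_classical all_reals all_analysis.
From mathcomp Require Import measurable_realfun.

Set Implicit Arguments.
Unset Strict Implicit.
Unset Printing Implicit Defensive.

Import Order.TTheory GRing.Theory Num.Theory.
Import numFieldNormedType.Exports.

Local Open Scope classical_set_scope.
Local Open Scope ring_scope.

(* The state space X * R_+ is represented by X * R: every condition below is
   imposed only at states (x, u) with 0 <= u, and only at times 0 <= t. *)

Section filtrations.
Context {dO dE : measure_display} {Omega : measurableType dO}
  {E : measurableType dE} {R : realType} (Pr : probability Omega R).

Definition sigma_generated (I : Type) (D : set I) (Y : I -> Omega -> E) :
    set (set Omega) :=
  <<s [set A | exists2 i, D i & exists2 B, measurable B & A = Y i @^-1` B] >>.

(* Y is a version of the conditional probability of the event A given the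
   sigma-algebra F. *)
Definition is_cond_prob (F : set (set Omega)) (A : set Omega)
    (Y : Omega -> \bar R) : Prop :=
  (forall B : set (\bar R), measurable B -> F (Y @^-1` B)) /\
  forall C, F C -> Pr (C `&` A) = (\int[Pr]_(w in C) Y w)%E.

End filtrations.

Section semi_markov.
Context {dO dX : measure_display} {Omega : measurableType dO}
  {X : measurableType dX} {R : realType}.

(* The right derivative is the weakest pointwise reading of g = dG/dt under
   which the generator below makes sense at every (x, t), t = 0 included. *)
Record is_sojourn_law (G g : X -> R -> R) : Prop := IsSojournLaw {
  sojourn_measurable : forall t, 0 <= t -> measurable_fun setT (G ^~ t) ;
  sojourn_ge0 : forall x t, 0 <= t -> 0 <= g x t ;
  sojourn_density : forall x t, 0 <= t ->
    (G x t)%:E = (\int[lebesgue_measure]_(s in `[0%R, t]) (g x s)%:E)%E ;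
  sojourn_derive : forall x t, 0 <= t ->
    h^-1 * (G x (t + h) - G x t) @[h --> 0^'+] --> g x t ;
  sojourn_total : forall x, G x t @[t --> +oo] --> (1 : R) }.

Definition Q_SM (P : R.-pker X ~> X) (G : X -> R -> R) (x : X) (B : set X)
    (t : R) : \bar R :=
  (P x B * (G x t)%:E)%E.

(* No explosion, i.e. almost surely finitely many tau_n lie below any t, is what
   makes nu(t) = sup {n : tau_n <= t} finite. *)
Record is_markov_renewal (Pr : probability Omega R) (P : R.-pker X ~> X)
    (G : X -> R -> R) (xn : nat -> Omega -> X) (tau : nat -> Omega -> R) :
    Prop := IsMarkovRenewal {
  renewal_measurable_state : forall n, measurable_fun setT (xn n) ;
  renewal_measurable_time : forall n, measurable_fun setT (tau n) ;
  renewal_start : {ae Pr, forall w, tau 0%N w = 0} ;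
  renewal_regular : {ae Pr, forall w, forall t : R,
    has_ubound [set n | tau n w <= t]} ;
  renewal_kernel : forall n B t, measurable B -> 0 <= t ->
    is_cond_prob Pr
      (sigma_generated [set k | (k <= n)%N] (fun k w => (xn k w, tau k w)))
      [set w | B (xn n.+1 w) /\ tau n.+1 w - tau n w <= t]
      (fun w => Q_SM P G (xn n w) B t) }.

Definition nu (tau : nat -> Omega -> R) (t : R) (w : Omega) : nat :=
  supremum 0%N [set n | tau n w <= t].

(* the pair (x_t, gamma(t)) *)
Definition semi_markov (xn : nat -> Omega -> X) (tau : nat -> Omega -> R)
    (t : R) (w : Omega) : X * R :=
  (xn (nu tau t w) w, t - tau (nu tau t w) w).

Definition generator (P : R.-pker X ~> X) (G g : X -> R -> R)
    (f : X * R -> R) (z : X * R) : R :=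
  (fun u : R => f (z.1, u))^`()%classic z.2 +
  g z.1 z.2 / (1 - G z.1 z.2) * \int[P z.1]_y (f (y, 0) - f z).

(* e^{tQ} f for the semigroup with transition kernels p_t. *)
Definition semigroup (p : R -> R.-pker (X * R)%type ~> (X * R)%type) (t : R)
    (f : X * R -> R) (z : X * R) : R :=
  \int[p t z]_y f y.

(* The semigroup is a family of Markov transition kernels whose infinitesimal
   generator (derivative at 0+, taken pointwise) is Q on bounded measurable
   functions differentiable in the second variable; operators then act on
   unbounded functions such as sigma^2 through the integral in semigroup.
   Two-sided differentiability in u at u = 0 costs no generality: a function on
   R_+ with a right derivative at 0 extends to a function differentiable there. *)
Record generates (Q : (X * R -> R) -> X * R -> R)
    (p : R -> R.-pker (X * R)%type ~> (X * R)%type) : Prop := Generates {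
  semigroup_supp : forall t z, 0 <= t -> 0 <= z.2 ->
    p t z [set y | 0 <= y.2] = 1%E ;
  semigroup0 : forall z B, 0 <= z.2 -> measurable B -> p 0 z B = \d_z B ;
  semigroupD : forall s t z B, 0 <= s -> 0 <= t -> 0 <= z.2 -> measurable B ->
    p (s + t) z B = (\int[p s z]_y p t y B)%E ;
  semigroup_generator : forall f : X * R -> R,
    measurable_fun setT f -> (exists M, forall z, `|f z| <= M) ->
    (forall x u, 0 <= u -> derivable (fun v : R => f (x, v)) u 1) ->
    forall z, 0 <= z.2 ->
    h^-1 * (semigroup p h f z - f z) @[h --> 0^'+] --> Q f z }.

Definition is_markov_process (Pr : probability Omega R)
    (Z : R -> Omega -> X * R)
    (p : R -> R.-pker (X * R)%type ~> (X * R)%type) : Prop :=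
  forall s t B, 0 <= s -> s <= t -> measurable B ->
    is_cond_prob Pr (sigma_generated `[0%R, s] Z) (Z t @^-1` B)
      (fun w => p (t - s) (Z s w) B).

End semi_markov.

Section volatility_swap.
Context {dO dX : measure_display} {Omega : measurableType dO}
  {X : measurableType dX} {R : realType}.

Definition realized_variance (sigma : X * R -> R) (Z : R -> Omega -> X * R)
    (T : R) (w : Omega) : R :=
  T^-1 * \int[lebesgue_measure]_(s in `[0%R, T]) (sigma (Z s w) ^+ 2).

(* volatility_path and volatility_L2 say that sigma_R^2 is almost surely finite with
   finite variance; without the former, the real-valued integral in
   realized_variance would silently be 0 when the true one is +oo. *)
Record admissible_volatility (Pr : probability Omega R) (sigma : X * R -> R)
    (Z : R -> Omega -> X * R) (T : R) : Prop := AdmissibleVolatility {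
  volatility_measurable : measurable_fun setT sigma ;
  volatility_path : {ae Pr, forall w,
    (@lebesgue_measure R).-integrable `[0%R, T]
      (fun s => (sigma (Z s w) ^+ 2)%:E)} ;
  volatility_L2 : Pr.-integrable setT
    (fun w => (realized_variance sigma Z T w ^+ 2)%:E) ;
  volatility_gt0 : (0 < 'E_Pr[realized_variance sigma Z T])%E }.

Definition volswap_value (Pr : probability Omega R) (r T K : R)
    (V : Omega -> R) : \bar R :=
  'E_Pr[fun w => expR (- (r * T)) * (Num.sqrt (V w) - K)].

(* expectation of the second-order Taylor polynomial of the square root at the
   mean of V, evaluated at V *)
Definition taylor2_mean_sqrt (Pr : probability Omega R) (V : Omega -> R) :
    \bar R :=
  let m := fine 'E_Pr[V] in
  'E_Pr[fun w => \sum_(k < 3)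
    (@Num.sqrt R)^`(k)%classic m / (k`!)%:R * (V w - m) ^+ k].

End volatility_swap.

(* Main.v *)
(* The pair Z_t = (x_t, gamma(t)) is jointly measurable in (t, w), because
   nu(t) = n + 1 is a countable combination of conditions tau_k <= t; no path
   regularity is involved. By the Markov property Z_t has law p_t(x, 0), and for
   s <= t, E[f(Z_s) g(Z_t)] = E[f(Z_s) (e^{(t-s)Q} g)(Z_s)]. For the realized
   variance V, Tonelli's theorem then expresses E[V] through
   m(t) = E[sigma^2(Z_t)], and E[V^2] through
   h(t, s) = E[sigma^2(Z_t) sigma^2(Z_s)], whose symmetry turns the integral
   over the square [0,T]^2 into twice the integral over the triangle s <= t.
   As sigma^2 is unbounded, m and h may be infinite on null sets, where the
   real-valued integrals of the statement take junk values. *)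

Require Import Defs.
From HB Require Import structures.
From mathcomp Require Import all_boot all_order all_algebra.
From mathcomp Require Import all_classical all_reals all_analysis.
From mathcomp Require Import measurable_realfun.
From mathcomp Require Import ring lra.

Import Order.TTheory GRing.Theory Num.Theory.
Import numFieldNormedType.Exports.

Local Open Scope classical_set_scope.
Local Open Scope ring_scope.

(** * Lebesgue integrals: almost-everywhere comparison, mixtures of measures, symmetric
    integrands *)

Section integral_lemmas.
Set Implicit Arguments.
Import HBNNSimple.
Local Open Scope ereal_scope.

(** The integral is a supremum over simple functions below [f]. Multiplying such a function by the
    indicator of the complement of the null set [N] keeps its integral and puts it below [g]
    everywhere. *)
Lemma le_ge0_integral_ae d (T : measurableType d) (R : realType)
    (mu : {measure set T -> \bar R}) (f g : T -> \bar R) :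
  (forall x, 0 <= f x) -> (forall x, 0 <= g x) ->
  {ae mu, forall x, f x <= g x} ->
  \int[mu]_x f x <= \int[mu]_x g x.
Proof.
move=> f0 g0 [N [mN N0 fgN]].
rewrite ge0_integralTE// ge0_integralTE//.
apply: ge_ereal_sup => _ [h /= hf <-].
pose h' := proj_nnsfun h (measurableC mN).
have -> : sintegral mu h = sintegral mu h'.
  rewrite -!integralT_nnsfun; apply: ge0_ae_eq_integral => //.
  - exact/measurable_EFinP.
  - exact/measurable_EFinP.
  - by move=> x _; rewrite lee_fin.
  - by move=> x _; rewrite lee_fin; exact: fun_ge0.
  - exists N; split => // x /= /not_implyP[_ hx]; apply: contrapT => Nx.
    by apply: hx; rewrite /h' /= mindicE mem_set// mulr1.
apply: ereal_sup_ubound; exists h' => //= x.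
rewrite mindicE; have [xN|xN] := boolP (x \in ~` N).
  rewrite mulr1 (le_trans (hf x))//; apply: contrapT => /negP fg.
  by move/set_mem : xN; apply; apply: fgN => /=; exact/negP.
by rewrite mulr0 g0.
Qed.

(* Unlike in [ae_eq_integral], neither function is assumed measurable. *)
Lemma eq_integral_ae d (T : measurableType d) (R : realType)
    (mu : {measure set T -> \bar R}) (D : set T) (f g : T -> \bar R) :
  {ae mu, forall x, D x -> f x = g x} ->
  \int[mu]_(x in D) f x = \int[mu]_(x in D) g x.
Proof.
move=> fg.
have {}fg : {ae mu, forall x, (f \_ D) x = (g \_ D) x}.
  by apply: filterS fg => x fgx; rewrite !patchE; case: ifPn => // /set_mem/fgx.
rewrite integral_mkcond [RHS]integral_mkcond integralE [RHS]integralE.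
by congr (_ - _); apply/eqP; rewrite eq_le; apply/andP; split;
  apply: le_ge0_integral_ae => //; apply: filterS fg => x fgx;
  rewrite unlock /= fgx.
Qed.

Lemma integral_probability_cst d (T : measurableType d) (R : realType)
    (P : probability T R) (c : \bar R) : \int[P]_x c = c.
Proof.
rewrite (integral_cst P measurableT c).
by rewrite [X in _ * X](_ : _ = 1) ?mule1//; exact: probability_setT.
Qed.

(** The simple functions [f_ n] do not depend on [x], so monotone convergence, used inside and then
    outside, leaves an expression that sees [k] only through the averaged masses [\int[mu]_x k x
    A]. *)
Lemma integral_mixtureE d d' (T : measurableType d) (U : measurableType d')
    (R : realType) (mu : {measure set T -> \bar R})
    (k : T -> {measure set U -> \bar R}) (f : U -> \bar R)
    (mf : measurable_fun setT f) (f_ := nnsfun_approx measurableT mf) :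
  (forall A, measurable A -> measurable_fun setT (k ^~ A)) ->
  (forall x, 0 <= f x) ->
  \int[mu]_x \int[k x]_y f y =
  limn (fun n => \sum_(r \in range (f_ n))
    (r%:E * \int[mu]_x k x (f_ n @^-1` [set r]))).
Proof.
move=> mk f0.
have kE x : \int[k x]_y f y = limn (fun n => sintegral (k x) (f_ n)).
  apply: nd_ge0_integral_lim => //.
    by move=> y m n mn; exact/lefP/nd_nnsfun_approx.
  by move=> y; exact: cvg_nnsfun_approx.
under eq_integral do rewrite kE.
have msint n : measurable_fun setT (fun x => sintegral (k x) (f_ n)).
  under eq_fun do rewrite sintegralE.
  by apply: emeasurable_fsum => // r; apply: measurable_funeM; exact: mk.
rewrite monotone_convergence//; last 2 first.
- by move=> n x _; exact: sintegral_ge0.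
- move=> x _ m n mn; apply: le_sintegral => y; exact/lefP/nd_nnsfun_approx.
congr (limn _); apply/funext => n.
under eq_integral do rewrite sintegralE.
rewrite ge0_integral_fsum//; last 2 first.
- by move=> r; apply: measurable_funeM; exact: mk.
- by move=> r x _; exact: nnsfun_mulemu_ge0.
apply: eq_fsbigr => r /set_mem[y _ <-].
by rewrite ge0_integralZl//; [exact: mk|rewrite lee_fin].
Qed.

(** This is the passage from events to functions: below, the Markov property is known on events and
    has to be applied to [sigma ^+ 2]. *)
Lemma eq_integral_mixture d d' d2 (T : measurableType d)
    (T' : measurableType d') (U : measurableType d2) (R : realType)
    (mu : {measure set T -> \bar R}) (nu : {measure set T' -> \bar R})
    (k : T -> {measure set U -> \bar R}) (l : T' -> {measure set U -> \bar R})
    (f : U -> \bar R) :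
  (forall A, measurable A -> measurable_fun setT (k ^~ A)) ->
  (forall A, measurable A -> measurable_fun setT (l ^~ A)) ->
  (forall A, measurable A -> \int[mu]_x k x A = \int[nu]_x l x A) ->
  measurable_fun setT f -> (forall x, 0 <= f x) ->
  \int[mu]_x \int[k x]_y f y = \int[nu]_x \int[l x]_y f y.
Proof.
move=> mk ml kl mf f0; rewrite !(integral_mixtureE _ _ mf)//.
congr (limn _); apply/funext => n; apply: eq_fsbigr => r _.
by rewrite kl.
Qed.

(** Cut the plane along the diagonal into [g1] ([s <= t]) and [g2] ([t < s]). Tonelli's theorem
    exchanges the variables in [g2], and symmetry of [h] then turns it into [g1] off the
    diagonal. *)
Lemma ge0_integral_symmetric (R : realType) (h : R * R -> \bar R) :
  measurable_fun setT h -> (forall z, 0 <= h z) ->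
  (forall s t, h (s, t) = h (t, s)) ->
  \int[lebesgue_measure]_t \int[lebesgue_measure]_s h (t, s) =
  2%:E * \int[lebesgue_measure]_t
    \int[lebesgue_measure]_(s in `]-oo, t]) h (t, s).
Proof.
move=> mh h0 hC.
pose g1 (z : R * R) := if (z.2 <= z.1)%R then h z else 0.
pose g2 (z : R * R) := if (z.1 < z.2)%R then h z else 0.
have mg1 : measurable_fun setT g1.
  apply: measurable_fun_ifT => //; exact: (measurable_fun_ler (f := snd)).
have mg2 : measurable_fun setT g2.
  apply: measurable_fun_ifT => //; exact: (measurable_fun_ltr (f := fst)).
have g10 z : 0 <= g1 z by rewrite /g1; case: ifP.
have g20 z : 0 <= g2 z by rewrite /g2; case: ifP.
have hE t s : h (t, s) = g1 (t, s) + g2 (t, s).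
  by rewrite /g1 /g2 /=; case: (ltP t s); rewrite ?add0e ?adde0.
under eq_integral => t _.
  under eq_integral do rewrite hE.
  rewrite ge0_integralD//;
    [|exact: measurableT_comp mg1 _|exact: measurableT_comp mg2 _].
  over.
rewrite /= ge0_integralD//; last 4 first.
- by move=> t _; exact: integral_ge0.
- exact: measurable_fun_fubini_tonelli_F.
- by move=> t _; exact: integral_ge0.
- exact: measurable_fun_fubini_tonelli_F.
rewrite [X in _ + X]fubini_tonelli//.
rewrite [X in _ + X](_ : _ =
    \int[lebesgue_measure]_t \int[lebesgue_measure]_s g1 (t, s)).
  rewrite -mule2n mule_natl; congr (_ *+ _).
  apply: eq_integral => t _; rewrite [RHS]integral_mkcond.
  apply: eq_integral => s _.
  rewrite patchE /g1 /=; case: ifPn => st; case: ifPn => //.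
    by rewrite notin_setE/= in_itv/= st.
  by rewrite inE/= in_itv/= (negbTE st).
apply: eq_integral => t _; apply: eq_integral_ae.
(* For fixed [t] the two integrands can differ only at the diagonal point [s = t]. *)
exists [set t]; split => //; first exact: lebesgue_measure_set1.
move=> s /= /not_implyP[_]; apply: contra_notP => /eqP st.
by rewrite /g1 /g2 /= hC lt_neqAle st.
Qed.

End integral_lemmas.

(** * Symmetric double integrals over a square, reduced to the triangle [0 <= s <= t <= T] *)

Section symmetric_double_integral.
Set Implicit Arguments.
Local Open Scope ereal_scope.
Context {R : realType}.
Local Notation mu := (@lebesgue_measure R).

Lemma integral_support d (T : measurableType d) (nu : {measure set T -> \bar R})
    (A B : set T) (f : T -> \bar R) :
  A `<=` B -> (forall x, B x -> ~ A x -> f x = 0) ->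
  \int[nu]_(x in B) f x = \int[nu]_(x in A) f x.
Proof.
move=> AB f0; rewrite integral_mkcond [RHS]integral_mkcond.
apply: eq_integral => x _; rewrite !patchE.
have [xA|xA] := boolP (x \in A).
  by rewrite mem_set//; exact/AB/set_mem.
case: ifPn => // /set_mem xB; apply: f0 => //; move: xA.
by rewrite notin_setE.
Qed.

Section support.
Variables (h : R * R -> \bar R) (T : R).
Hypotheses (mh : measurable_fun setT h) (h0 : forall z, 0 <= h z)
  (hC : forall s t, h (s, t) = h (t, s))
  (hT : forall t s, ~~ (0 <= t <= T)%R -> h (t, s) = 0).

Let H t := \int[mu]_(s in `[0%R, t]) h (t, s).

Let HE t : \int[mu]_(s in `]-oo, t]) h (t, s) = H t.
Proof.
apply: integral_support => s /=; rewrite !in_itv/=; first by move=> /andP[].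
(* [hT] constrains the first argument; symmetry carries the vanishing over to negative [s]. *)
by move=> st /negP; rewrite st andbT => s0; rewrite hC hT// (negbTE s0).
Qed.

Let mH : measurable_fun setT H.
Proof.
(* The domain varying with [t] is moved into the integrand, where Tonelli's theorem gives
   measurability in [t]. *)
pose g (z : R * R) := if (z.2 <= z.1)%R then h z else 0.
rewrite (_ : H = fun t => \int[mu]_s g (t, s)).
  apply: measurable_fun_fubini_tonelli_F; last first.
    by move=> z; rewrite /g; case: ifP.
  by apply: measurable_fun_ifT => //; exact: (measurable_fun_ler (f := snd)).
apply/funext => t; rewrite -HE integral_mkcond; apply: eq_integral => s _.
by rewrite patchE mem_setE in_itv.
Qed.

Let H0 t : 0 <= H t. Proof. exact: integral_ge0. Qed.

Lemma ge0_integral_triangle :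
  \int[mu]_t \int[mu]_s h (t, s) =
  2%:E * \int[mu]_(t in `[0%R, T]) \int[mu]_(s in `[0%R, t]) h (t, s).
Proof.
rewrite (ge0_integral_symmetric mh h0 hC).
under eq_integral do rewrite HE.
have -> // : \int[mu]_t H t = \int[mu]_(t in `[0%R, T]) H t.
apply: integral_support => // t _ /= /negP; rewrite in_itv/= => tT.
by apply: integral0_eq => s _; exact: hT.
Qed.

Hypothesis hoo : \int[mu]_t \int[mu]_s h (t, s) < +oo.

Lemma integrable_triangle_outer :
  mu.-integrable `[0%R, T] (fun t => \int[mu]_(s in `[0%R, t]) h (t, s)).
Proof.
apply/integrableP; split; first exact: measurable_funTS mH.
under eq_integral do rewrite gee0_abs ?integral_ge0//.
apply: le_lt_trans hoo; rewrite ge0_integral_triangle.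
apply: lee_pemull; last by rewrite lee_fin ler1n.
by apply: integral_ge0 => t _; exact: H0.
Qed.

Lemma integrable_triangle_inner :
  {ae mu, forall t, `[0%R, T]%classic t ->
    mu.-integrable `[0%R, t] (fun s => h (t, s))}.
Proof.
have := integrable_ae _ integrable_triangle_outer.
move=> /(_ (measurable_itv _)); apply: filterS => t Ht /Ht Hfin.
apply/integrableP; split; first exact/measurable_funTS/measurableT_comp.
by under eq_integral do rewrite gee0_abs//; rewrite ltey_eq Hfin.
Qed.

End support.

(** Integrability makes [f] and [g] finite almost everywhere, so the values of [F] at points where
    one of them is infinite do not affect the integral. *)
Lemma ae_integralB d (U : measurableType d) (nu : {measure set U -> \bar R})
    (D : set U) (f g : U -> \bar R) (F : U -> R) :
  measurable D -> nu.-integrable D f -> nu.-integrable D g ->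
  {ae nu, forall x, D x -> f x \is a fin_num -> g x \is a fin_num ->
    F x = (fine (f x) - fine (g x))%R} ->
  \int[nu]_(x in D) (F x)%:E = \int[nu]_(x in D) f x - \int[nu]_(x in D) g x.
Proof.
move=> mD intf intg FE; rewrite -integralB//; apply: eq_integral_ae.
have := integrable_ae mD intg; have := integrable_ae mD intf; move: FE.
apply: filterS3 => x Fx fx gx Dx; rewrite Fx ?fx ?gx//.
by rewrite EFinB !fineK ?fx ?gx.
Qed.

(** Meant for [h] the mixed second moment, [g] the product of means and [F] the integrand of the
    variance formula. Both real-valued integrals apply [fine]; this is harmless since the outer
    integrals are finite and the inner ones are finite for almost every [t]. *)
Lemma Rintegral_triangleB (h g : R * R -> \bar R) (T : R) (F : R -> R -> R) :
  measurable_fun setT h -> (forall z, 0 <= h z) ->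
  (forall s t, h (s, t) = h (t, s)) ->
  (forall t s, ~~ (0 <= t <= T)%R -> h (t, s) = 0) ->
  \int[mu]_t \int[mu]_s h (t, s) < +oo ->
  measurable_fun setT g -> (forall z, 0 <= g z) ->
  (forall s t, g (s, t) = g (t, s)) ->
  (forall t s, ~~ (0 <= t <= T)%R -> g (t, s) = 0) ->
  \int[mu]_t \int[mu]_s g (t, s) < +oo ->
  (forall t s, (0 <= s)%R -> (s <= t)%R -> (t <= T)%R ->
    h (t, s) \is a fin_num -> g (t, s) \is a fin_num ->
    F t s = (fine (h (t, s)) - fine (g (t, s)))%R) ->
  (2 * (\int[mu]_(t in `[0, T]) \int[mu]_(s in `[0, t]) F t s))%R%:E =
  \int[mu]_t \int[mu]_s h (t, s) - \int[mu]_t \int[mu]_s g (t, s).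
Proof.
move=> mh h0 hC hT hoo mg g0 gC gT goo FE.
rewrite (ge0_integral_triangle _ mh h0 hC hT).
rewrite (ge0_integral_triangle _ mg g0 gC gT).
have oh := integrable_triangle_outer _ mh h0 hC hT hoo.
have og := integrable_triangle_outer _ mg g0 gC gT goo.
have /(_ (measurable_itv _)) fh := integrable_fin_num _ oh.
have /(_ (measurable_itv _)) fg := integrable_fin_num _ og.
rewrite -[X in 2%:E * X - _]fineK// -[X in _ - _ * X]fineK//.
rewrite -!EFinM -EFinB -mulrBr; congr (_ * _)%:E.
rewrite -fineB//; congr fine; apply: ae_integralB => //.
have := integrable_triangle_inner _ mg g0 gC gT goo.
have := integrable_triangle_inner _ mh h0 hC hT hoo.
apply: filterS2; first exact: (ae_filter_ringOfSetsType mu).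
move=> t ih ig tT _ _; have {}ih := ih tT; have {}ig := ig tT.
move: tT; rewrite /= in_itv/= => /andP[t0 tleT].
rewrite -fineB ?integrable_fin_num//; congr fine.
apply: ae_integralB => //; apply: aeW => s; rewrite /= in_itv/= => /andP[s0 st].
exact: FE.
Qed.

End symmetric_double_integral.

(* With [fine] sending both infinities to 0, no finiteness is needed. *)
Lemma fine_mul (R : realDomainType) (x y : \bar R) :
  fine (x * y)%E = fine x * fine y.
Proof.
have fineNy (r : R) (z : \bar R) : fine z = 0 -> fine ((Num.sg r)%:E * z)%E = 0.
  move=> z0; case: sgrP => _;
    by rewrite ?mul0e ?mul1e ?EFinN ?mulN1e ?fineN ?z0 ?oppr0.
case: x y => [r| |] [s| |].
- by [].
- by rewrite mulry fineNy //= mulr0.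
- by rewrite mulrNy fineNy //= mulr0.
- by rewrite mulyr fineNy //= mul0r.
- by rewrite mulyy /= mul0r.
- by rewrite mulyNy /= mul0r.
- by rewrite mulNyr fineNy //= mul0r.
- by rewrite mulNyy /= mul0r.
- by rewrite mulNyNy /= mul0r.
Qed.

(** * Joint measurability of the semi-Markov pair in time and outcome *)

Section semi_markov_measurability.
Set Implicit Arguments.
Context {dO dX : measure_display} {Omega : measurableType dO}
  {X : measurableType dX} {R : realType}.
Variables (xn : nat -> Omega -> X) (tau : nat -> Omega -> R).
Hypotheses (mxn : forall n, measurable_fun setT (xn n))
  (mtau : forall n, measurable_fun setT (tau n)).

(** A successor differs from the default value 0 of [supremum], so it can only be a genuine least
    upper bound. The value 0 is ambiguous: it also arises when the set is empty or unbounded. *)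
Lemma nu_eqS (t : R) (w : Omega) (n : nat) :
  nu tau t w = n.+1 <->
  tau n.+1 w <= t /\ forall k, (n.+1 < k)%N -> t < tau k w.
Proof.
rewrite /nu; set S := [set _ | _]; split => [Sn|[Sn Sk]].
  have SS : has_sup S by apply: contrapT => /(supremum_out 0%N); rewrite Sn.
  have : supremums S n.+1.
    move: Sn; rewrite /supremum; case: ifPn => // _.
    by case: xgetP => //= m -> Sm <-.
  move=> [ubS lbS]; split.
    (* A least upper bound in [nat] is attained: otherwise its predecessor [n] would be an upper
       bound too. *)
    apply: contrapT => nS.
    suff /lbS : ubound S n by rewrite leEnat ltnn.
    move=> k Sk; have := ubS _ Sk; rewrite !leEnat leq_eqVlt => /predU1P[kn|//].
    by rewrite kn in Sk.
  move=> k nk; rewrite ltNge; apply/negP => /ubS.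
  by rewrite leEnat leqNgt nk.
have ubS : ubound S n.+1.
  by move=> k /= tk; rewrite leEnat leqNgt; apply/negP => /Sk; rewrite ltNge tk.
rewrite /supremum; case: ifPn => [/eqP S0|_].
  by have : S n.+1 by []; rewrite S0.
case: xgetP => [m -> Sm|/(_ n.+1)[]].
  apply: (is_subset1_supremums Sm); split => // m' /(_ _ Sn) //.
by split => // m' /(_ _ Sn).
Qed.

Lemma measurable_nu_eq (n : nat) :
  measurable [set z : R * Omega | nu tau z.1 z.2 = n].
Proof.
have mS k : measurable [set z : R * Omega | nu tau z.1 z.2 = k.+1].
  have mtauz j : measurable_fun setT (fun z : R * Omega => tau j z.2).
    exact: measurableT_comp.
  rewrite (_ : mkset _ = [set z | tau k.+1 z.2 <= z.1] `&`
      \bigcap_(j in [set j | (k.+1 < j)%N]) [set z | z.1 < tau j z.2]);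
      last first.
    apply/seteqP; split => z /=; first by move/nu_eqS => [].
    by move=> ?; apply/nu_eqS.
  apply: measurableI.
    rewrite -[X in measurable X]setTI.
    exact: (@measurable_fun_ler _ _ _ setT _ _ (mtauz _) measurable_fst
      measurableT [set true]).
  apply: bigcap_measurable => [|j _]; first by exists k.+2 => /=.
  rewrite -[X in measurable X]setTI.
  exact: (@measurable_fun_ltr _ _ _ setT _ _ measurable_fst (mtauz _)
    measurableT [set true]).
(* The event for 0, default cases included, is the complement of all the events for successors. *)
case: n => // ; rewrite (_ : mkset _ =
    ~` \bigcup_k [set z : R * Omega | nu tau z.1 z.2 = k.+1]).
  by apply: measurableC; exact: bigcup_measurable.
apply/seteqP; split => z /=; first by move=> z0 [k _ /=]; rewrite z0.
case E : (nu tau z.1 z.2) => [//|k] h; exfalso; apply: h; exists k => //.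
Qed.

Lemma measurable_semi_markov :
  measurable_fun setT (fun z : R * Omega => semi_markov xn tau z.1 z.2).
Proof.
rewrite (_ : setT = \bigcup_n [set z : R * Omega | nu tau z.1 z.2 = n]);
    last first.
  by apply/seteqP; split => // z _; exists (nu tau z.1 z.2).
apply/measurable_fun_bigcup; first exact: measurable_nu_eq.
move=> n; apply: (eq_measurable_fun
  (fun z : R * Omega => (xn n z.2, z.1 - tau n z.2))) => [z|].
  by rewrite inE /= /semi_markov => ->.
apply: measurable_funTS; apply: measurable_fun_pair.
  exact: measurableT_comp.
by apply: measurable_funB => //; exact: measurableT_comp.
Qed.

End semi_markov_measurability.

(** * One-time and two-time moments of a Markov process *)

Section markov_moments.
Set Implicit Arguments.
Local Open Scope ereal_scope.
Context {dO dX : measure_display} {Omega : measurableType dO}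
  {X : measurableType dX} {R : realType}.
Variables (Pr : probability Omega R) (Z : R -> Omega -> X * R)
  (p : R -> R.-pker (X * R)%type ~> (X * R)%type).
Hypotheses (mZ : forall t, measurable_fun setT (Z t))
  (hZ : is_markov_process Pr Z p).

Let measurable_diracZ t A : measurable A ->
  measurable_fun setT (fun w => \d_(Z t w) A : \bar R).
Proof.
move=> mA; apply: (measurableT_comp (f := fun z => \d_z A)) => //.
exact: measurable_fun_dirac.
Qed.

Let measurable_ker_Z s t A : measurable A ->
  measurable_fun setT (fun w => p t (Z s w) A).
Proof.
by move=> mA; apply: measurableT_comp (measurable_kernel (p t) _ mA) _.
Qed.

Let markov_indic s t A B : (0 <= s)%R -> (s <= t)%R ->
  measurable A -> measurable B ->
  Pr (Z s @^-1` A `&` Z t @^-1` B) =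
  \int[Pr]_(w in Z s @^-1` A) p (t - s)%R (Z s w) B.
Proof.
move=> s0 st mA mB; have [_ +] := @hZ s t B s0 st mB; apply.
apply: sub_gen_smallest; exists s; first by rewrite /= in_itv/= s0 lexx.
by exists A.
Qed.

Lemma integral_markov_law (z0 : X * R) t (f : X * R -> \bar R) :
  {ae Pr, forall w, Z 0%R w = z0} -> (0 <= t)%R ->
  measurable_fun setT f -> (forall z, 0 <= f z) ->
  \int[Pr]_w f (Z t w) = \int[p t z0]_y f y.
Proof.
move=> Z0 t0 mf f0.
(* Evaluation at [Z t w] is integration against a Dirac measure, so both sides become mixtures and
   only events remain to be compared. *)
transitivity (\int[Pr]_w \int[\d_(Z t w)]_y f y).
  by apply: eq_integral => w _; rewrite integral_dirac// diracT mul1e.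
pose c := \int[p t z0]_y f y.
transitivity (\int[Pr]_w c); last first.
  exact: integral_probability_cst.
apply: (@eq_integral_mixture _ _ _ _ _ _ _ _ _ (fun w => \d_(Z t w))
   (fun=> p t z0)) => //.
  exact: measurable_diracZ.
move=> A mA; rewrite integral_probability_cst.
transitivity (Pr (Z t @^-1` A)).
  rewrite -[in RHS](setIT (Z t @^-1` A)) -integral_indic//.
  by rewrite -[X in measurable X]setTI; exact: mZ.
(* The Markov property from time 0 with the full event; [Z 0] is then replaced by [z0] almost
   surely. *)
have := @markov_indic 0%R t setT A (lexx _) t0 measurableT mA.
rewrite preimage_setT setTI => ->; rewrite subr0.
transitivity (\int[Pr]_w p t z0 A).
  by apply: eq_integral_ae; apply: filterS Z0 => w ->.
by rewrite integral_probability_cst.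
Qed.

(** Mixtures are compared twice: first with weight [phi (Z s w)], which reduces [psi] to the
    indicator of an event [B]; then with Dirac measures at [Z s w], which reduces [phi] to the
    indicator of an event [A]. What is left is the Markov property on events. *)
Lemma integral_markov2 s t (phi : X * R -> R) (psi : X * R -> \bar R) :
  (0 <= s)%R -> (s <= t)%R ->
  measurable_fun setT phi -> (forall z, (0 <= phi z)%R) ->
  measurable_fun setT psi -> (forall z, 0 <= psi z) ->
  \int[Pr]_w ((phi (Z s w))%:E * psi (Z t w)) =
  \int[Pr]_w ((phi (Z s w))%:E * \int[p (t - s)%R (Z s w)]_y psi y).
Proof.
move=> s0 st mphi phi0 mpsi psi0.
have mphiZ : measurable_fun setT (fun w => (phi (Z s w))%:E).
  by apply/measurable_EFinP; exact: measurableT_comp.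
have mphiE : measurable_fun setT (EFin \o phi) by exact/measurable_EFinP.
pose phin w := NngNum (phi0 (Z s w)).
transitivity (\int[Pr]_w \int[mscale (phin w) (\d_(Z t w))]_y psi y).
  apply: eq_integral => w _.
  by rewrite ge0_integral_mscale// integral_dirac// diracT mul1e.
transitivity (\int[Pr]_w \int[mscale (phin w) (p (t - s)%R (Z s w))]_y psi y);
  last by apply: eq_integral => w _; rewrite ge0_integral_mscale.
apply: (@eq_integral_mixture _ _ _ _ _ _ _ _ _
   (fun w => mscale (phin w) (\d_(Z t w)))
   (fun w => mscale (phin w) (p (t - s)%R (Z s w)))) => //.
- by move=> A mA; apply: emeasurable_funM => //; exact: measurable_diracZ.
- by move=> A mA; apply: emeasurable_funM => //; exact: measurable_ker_Z.
move=> B mB; rewrite /mscale /=.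
have mZB : measurable (Z t @^-1` B).
  by rewrite -[X in measurable X]setTI; exact: mZ.
have pge0 w : (0 <= fine (p (t - s)%R (Z s w) B))%R by exact: fine_ge0.
(* [mscale] takes nonnegative real weights, so the transition probability must be exhibited as a
   real number. *)
have pE w : p (t - s)%R (Z s w) B = (fine (p (t - s)%R (Z s w) B))%:E.
  rewrite fineK// ge0_fin_numE//.
  rewrite (@le_lt_trans _ _ (p (t - s)%R (Z s w) setT))//.
    by apply: le_measure; rewrite ?inE.
  by rewrite prob_kernel ltry.
have i0 w : (0 <= \1_B (Z t w) :> R)%R by [].
transitivity
  (\int[Pr]_w \int[mscale (NngNum (i0 w)) (\d_(Z s w))]_y (phi y)%:E).
  apply: eq_integral => w _; rewrite ge0_integral_mscale//; last first.
    by move=> y _; rewrite lee_fin.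
  by rewrite integral_dirac// diracT mul1e muleC.
transitivity
  (\int[Pr]_w \int[mscale (NngNum (pge0 w)) (\d_(Z s w))]_y (phi y)%:E);
    last first.
  apply: eq_integral => w _; rewrite ge0_integral_mscale//; last first.
    by move=> y _; rewrite lee_fin.
  by rewrite integral_dirac// diracT mul1e muleC /mscale/= -pE.
apply: (@eq_integral_mixture _ _ _ _ _ _ _ _ _
   (fun w => mscale (NngNum (i0 w)) (\d_(Z s w)))
   (fun w => mscale (NngNum (pge0 w)) (\d_(Z s w)))) => //.
- move=> A mA; apply: emeasurable_funM; last exact: measurable_diracZ.
  exact: measurable_diracZ.
- move=> A mA; apply: emeasurable_funM; last exact: measurable_diracZ.
  by under eq_fun do rewrite /= -pE; exact: measurable_ker_Z.
move=> A mA; rewrite /mscale/=.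
have mZA : measurable (Z s @^-1` A).
  by rewrite -[X in measurable X]setTI; exact: mZ.
transitivity (Pr (Z s @^-1` A `&` Z t @^-1` B)).
  rewrite -[in RHS](setIT (_ `&` _)) -integral_indic//; last exact: measurableI.
  by apply: eq_integral => w _; rewrite indicI /= EFinM muleC.
rewrite markov_indic// integral_mkcond; apply: eq_integral => w _.
rewrite patchE /mscale /= -pE diracE; case: ifPn => wA.
  by rewrite mem_set ?mule1//; exact: set_mem wA.
by rewrite memNset ?mule0//; move: wA; rewrite notin_setE.
Qed.

End markov_moments.

(** * First and second moments of the realized variance *)

Section realized_variance_moments.
Set Implicit Arguments.
Local Open Scope ereal_scope.
Context {dO dX : measure_display} {Omega : measurableType dO}
  {X : measurableType dX} {R : realType}.
Variables (Pr : probability Omega R) (Z : R -> Omega -> X * R)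
  (p : R -> R.-pker (X * R)%type ~> (X * R)%type) (z0 : X * R)
  (sigma : X * R -> R) (T : R).
Hypotheses (mZ : measurable_fun setT (fun z : R * Omega => Z z.1 z.2))
  (hZ : is_markov_process Pr Z p) (hz0 : {ae Pr, forall w, Z 0%R w = z0})
  (T0 : (0 < T)%R) (hsigma : admissible_volatility Pr sigma Z T).
Local Notation mu := (@lebesgue_measure R).
Local Notation V := (realized_variance sigma Z T).

Let sigma2 (z : X * R) : R := (sigma z ^+ 2)%R.

Let msigma2 : measurable_fun setT sigma2.
Proof. by apply: measurable_funX; exact: volatility_measurable hsigma. Qed.

Let msigma2E : measurable_fun setT (EFin \o sigma2).
Proof. exact/measurable_EFinP. Qed.

Let sigma2_ge0 z : (0 <= sigma2 z)%R. Proof. exact: sqr_ge0. Qed.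

Let mZt t : measurable_fun setT (Z t).
Proof. exact: (measurable_fun_pair2 t mZ). Qed.

(** Setting the integrand to 0 outside [[0, T]] lets Tonelli's theorem run on the whole line. Below,
    [U] is [T] times the realized variance before [fine] is applied. *)
Let a (z : R * Omega) : \bar R :=
  if (0 <= z.1 <= T)%R then (sigma2 (Z z.1 z.2))%:E else 0.

Let ma : measurable_fun setT a.
Proof.
apply: measurable_fun_ifT => //.
  by apply: measurable_and; exact: measurable_fun_ler.
by apply/measurable_EFinP; exact: measurableT_comp.
Qed.

Let ma1 t : measurable_fun setT (fun w => a (t, w)).
Proof. exact: measurable_fun_pair2. Qed.

Let a_ge0 z : 0 <= a z. Proof. by rewrite /a; case: ifP; rewrite ?lee_fin. Qed.

Let aT t w : (0 <= t <= T)%R -> a (t, w) = (sigma2 (Z t w))%:E.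
Proof. by rewrite /a /= => ->. Qed.

Let aN t w : ~~ (0 <= t <= T)%R -> a (t, w) = 0.
Proof. by rewrite /a /= => /negbTE ->. Qed.

Let U w := \int[mu]_s a (s, w).
Let m t := \int[Pr]_w a (t, w).
Let h (z : R * R) := \int[Pr]_w (a (z.1, w) * a (z.2, w)).

Let mU : measurable_fun setT U.
Proof. exact: measurable_fun_fubini_tonelli_G. Qed.

Let U_ge0 w : 0 <= U w. Proof. exact: integral_ge0. Qed.

Let mm : measurable_fun setT m.
Proof. exact: measurable_fun_fubini_tonelli_F. Qed.

Let m_ge0 t : 0 <= m t. Proof. exact: integral_ge0. Qed.

Let mh : measurable_fun setT h.
Proof.
pose b (z : (R * R) * Omega) := a (z.1.1, z.2) * a (z.1.2, z.2).
apply: (measurable_fun_fubini_tonelli_F b); last by move=> z; exact: mule_ge0.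
apply: emeasurable_funM; apply: measurableT_comp => //;
  by apply: measurable_fun_pair => //; exact: measurableT_comp.
Qed.

Let h_ge0 z : 0 <= h z.
Proof. by apply: integral_ge0 => w _; exact: mule_ge0. Qed.

Let hC s t : h (s, t) = h (t, s).
Proof. by apply: eq_integral => w _; rewrite muleC. Qed.

Let hN t s : ~~ (0 <= t <= T)%R -> h (t, s) = 0.
Proof. by move=> tT; apply: integral0_eq => w _; rewrite aN// mul0e. Qed.

Let mN t : ~~ (0 <= t <= T)%R -> m t = 0.
Proof. by move=> tT; apply: integral0_eq => w _; rewrite aN. Qed.

Let UE w : U w = \int[mu]_(s in `[0%R, T]) (sigma (Z s w) ^+ 2)%:E.
Proof.
rewrite [RHS]integral_mkcond; apply: eq_integral => s _.
by rewrite patchE mem_setE in_itv.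
Qed.

Let VE w : V w = (T^-1 * fine (U w))%R.
Proof. by rewrite /realized_variance /Rintegral -UE. Qed.

Let U_fin : {ae Pr, forall w, U w \is a fin_num}.
Proof.
have := volatility_path hsigma; apply: filterS => w iw.
by rewrite UE; exact: integrable_fin_num.
Qed.

Let UfinE : {ae Pr, forall w, U w = (T * V w)%:E}.
Proof.
apply: filterS U_fin => w Uw.
by rewrite VE mulrA divff ?gt_eqF// mul1r fineK.
Qed.

Lemma measurable_realized_variance : measurable_fun setT V.
Proof.
rewrite (_ : V = (fun w => T^-1 * fine (U w))%R); last exact/funext.
by apply: measurable_funM => //; exact: measurableT_comp.
Qed.

Lemma realized_variance_ge0 w : (0 <= V w)%R.
Proof. by rewrite VE mulr_ge0 ?invr_ge0 ?(ltW T0)// fine_ge0. Qed.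

(** Domination by [1 + V w ^+ 2], which is integrable by [volatility_L2] because [Pr] is finite. *)
Lemma integrable_realized_variance : Pr.-integrable setT (EFin \o V).
Proof.
have i1 : Pr.-integrable setT (fun w => (1 + V w ^+ 2)%:E).
  under eq_fun do rewrite EFinD; apply: integrableD => //.
    exact: finite_measure_integrable_cst.
  exact: volatility_L2 hsigma.
apply: le_integrable i1 => //.
  exact/measurable_EFinP/measurable_realized_variance.
move=> w _; rewrite /= lee_fin ger0_norm ?realized_variance_ge0// ger0_norm.
  by have := realized_variance_ge0 w; nra.
by rewrite addr_ge0 ?sqr_ge0.
Qed.

Let intm : \int[mu]_t m t = T%:E * 'E_Pr[V].
Proof.
transitivity (\int[Pr]_w U w).
  exact: (fubini_tonelli (m1 := mu) (m2 := Pr) a).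
rewrite unlock.
transitivity (\int[Pr]_w (T%:E * (V w)%:E)); last first.
  by rewrite integralZl//; exact: integrable_realized_variance.
by apply: eq_integral_ae; apply: filterS UfinE => w -> _; rewrite EFinM.
Qed.

(** Tonelli's theorem in [s] gives the expectation of [a (t, w) * U w]; a second use in [t] gives
    that of the square of [U], and [U] equals [T * V] almost surely. *)
Let inth :
  \int[mu]_t \int[mu]_s h (t, s) = (T ^+ 2)%:E * 'E_Pr[V ^+ 2].
Proof.
have hE t : \int[mu]_s h (t, s) = \int[Pr]_w (a (t, w) * U w).
  pose b (z : R * Omega) := a (t, z.2) * a z.
  transitivity (\int[Pr]_w \int[mu]_s b (s, w)).
    apply: (fubini_tonelli (m1 := mu) (m2 := Pr) b); last first.
      by move=> z; exact: mule_ge0.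
    by apply: emeasurable_funM => //; apply: (measurableT_comp (ma1 t)).
  apply: eq_integral => w _; rewrite /b /=.
  have [tT|tT] := boolP (0 <= t <= T)%R.
    rewrite aT// ge0_integralZl//; first exact: measurable_fun_pair1.
    by rewrite lee_fin.
  by rewrite aN// mul0e; apply: integral0_eq => s _; rewrite mul0e.
under eq_integral do rewrite hE.
pose b (z : R * Omega) := a z * U z.2.
transitivity (\int[Pr]_w \int[mu]_t b (t, w)).
  apply: (fubini_tonelli (m1 := mu) (m2 := Pr) b); last first.
    by move=> z; exact: mule_ge0.
  by apply: emeasurable_funM => //; exact: measurableT_comp.
rewrite unlock.
transitivity (\int[Pr]_w ((T ^+ 2)%:E * (V w ^+ 2)%:E)); last first.
  by rewrite integralZl//; exact: volatility_L2 hsigma.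
apply: eq_integral_ae; apply: filterS UfinE => w UV _.
rewrite /b /= UV ge0_integralZr//; last 2 first.
- exact: measurable_fun_pair1.
- by rewrite lee_fin mulr_ge0 ?(ltW T0) ?realized_variance_ge0.
by rewrite -/(U w) UV -!EFinM mulrACA !expr2.
Qed.

Let semigroup_mean t : (0 <= t <= T)%R -> semigroup p t sigma2 z0 = fine (m t).
Proof.
move=> tT; have /andP[t0 _] := tT; congr fine.
rewrite -(integral_markov_law mZt hZ _ hz0 t0 msigma2E) => [|z]; last first.
  by rewrite lee_fin.
by apply: eq_integral => w _; rewrite aT.
Qed.

Let semigroup_product s t : (0 <= s)%R -> (s <= t)%R -> (t <= T)%R ->
  h (t, s) \is a fin_num ->
  semigroup p s (fun z => sigma2 z * semigroup p (t - s) sigma2 z)%R z0 =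
  fine (h (t, s)).
Proof.
move=> s0 st tT hfin.
pose K z := \int[p (t - s)%R z]_y (sigma2 y)%:E.
have mK : measurable_fun setT K.
  apply: measurable_fun_integral_kernel => //; exact: measurable_kernel.
have K0 z : 0 <= K z by apply: integral_ge0 => y _; rewrite lee_fin.
have hE : h (t, s) = \int[p s z0]_z ((sigma2 z)%:E * K z).
  rewrite hC -(integral_markov_law mZt hZ _ hz0 s0
    (f := fun z => (sigma2 z)%:E * K z)); last 2 first.
  - exact: emeasurable_funM.
  - by move=> z; rewrite mule_ge0 ?lee_fin.
  rewrite -(integral_markov2 mZt hZ _ _ s0 st msigma2 sigma2_ge0 msigma2E)//.
  apply: eq_integral => w _.
  by rewrite !aT// ?s0 ?(le_trans st)// (le_trans s0).
rewrite hE; congr fine; apply: eq_integral_ae.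
(* Finiteness of [h (t, s)] makes the product finite almost everywhere under [p s z0], so using the
   real-valued [semigroup] in place of [K] changes the integrand only on a null set. *)
have iK : (p s z0).-integrable setT (fun z => (sigma2 z)%:E * K z).
  apply/integrableP; split; first exact: emeasurable_funM.
  under eq_integral do rewrite gee0_abs ?mule_ge0 ?lee_fin//.
  by rewrite -hE ltey_eq hfin.
have := integrable_ae measurableT iK; apply: filterS => z /(_ Logic.I) + _.
rewrite /semigroup /Rintegral -/(K z).
(* [K z = +oo] leaves the product finite only if [sigma2 z = 0], and then the
   junk value [fine +oo = 0] does no harm. *)
move: (sigma2 z) (sigma2_ge0 z) (K z) (K0 z) => r r0 [k| |]// _.
have [->|r_neq0] := eqVneq r 0%R; first by rewrite mul0r mul0e.
by rewrite mulry gtr0_sg ?mul1e// lt_neqAle eq_sym r_neq0.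
Qed.

Let EV_fin : 'E_Pr[V] \is a fin_num.
Proof.
by rewrite unlock; exact: integrable_fin_num integrable_realized_variance.
Qed.

Let EV2_fin : 'E_Pr[V ^+ 2] \is a fin_num.
Proof. by rewrite unlock; exact: integrable_fin_num (volatility_L2 hsigma). Qed.

Let im : mu.-integrable setT m.
Proof.
apply/integrableP; split => //.
under eq_integral do rewrite gee0_abs//.
by rewrite intm -(fineK EV_fin) -EFinM ltry.
Qed.

(** The mean function [m] has a finite integral, hence is finite for almost every [t], and there the
    real-valued semigroup agrees with it. *)
Lemma mean_realized_varianceE :
  (T^-1 * \int[mu]_(t in `[0, T]) semigroup p t (fun z => sigma z ^+ 2) z0)%R =
  fine 'E_Pr[V].
Proof.
rewrite /Rintegral (_ : \int[mu]_(t in `[0%R, T]) _ = \int[mu]_t m t).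
  by rewrite intm fineM// mulrA mulVf ?gt_eqF// mul1r.
transitivity (\int[mu]_(t in `[0%R, T]) m t); last first.
  by apply/esym/integral_support => // t _ /= /negP; rewrite in_itv; exact: mN.
apply: eq_integral_ae; have := integrable_ae measurableT im.
apply: filterS => t /(_ Logic.I) mt /=; rewrite in_itv/= => tT.
by rewrite semigroup_mean// fineK.
Qed.

Lemma variance_realized_varianceE :
  'E_Pr[V ^+ 2] - 'E_Pr[V] ^+ 2 =
  (2 / T ^+ 2 * \int[mu]_(t in `[0, T]) \int[mu]_(s in `[0, t])
     (semigroup p s (fun z => sigma z ^+ 2 *
         semigroup p (t - s) (fun z => sigma z ^+ 2) z) z0 -
      semigroup p t (fun z => sigma z ^+ 2) z0 *
      semigroup p s (fun z => sigma z ^+ 2) z0))%R%:E.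
Proof.
(* The double integral of [g] is the square of [T] times the mean, just as that of [h] is [T ^+ 2]
   times the second moment; their difference is then taken over the triangle. *)
pose g (z : R * R) := m z.1 * m z.2.
have mg : measurable_fun setT g.
  by apply: emeasurable_funM; exact: measurableT_comp.
have intg : \int[mu]_t \int[mu]_s g (t, s) =
    (T%:E * 'E_Pr[V]) * (T%:E * 'E_Pr[V]).
  have TEV : T%:E * 'E_Pr[V] = (T * fine 'E_Pr[V])%:E by rewrite EFinM fineK.
  transitivity (\int[mu]_t (m t * (T%:E * 'E_Pr[V]))).
    apply: eq_integral_ae; have := integrable_ae measurableT im.
    apply: filterS => t /(_ Logic.I) mt _.
    rewrite /g /= -(fineK mt) ge0_integralZl//; first by rewrite intm.
    by rewrite lee_fin fine_ge0.
  by rewrite TEV integralZr// intm TEV.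
have := @Rintegral_triangleB R h g T (fun t s =>
    (semigroup p s (fun z => sigma z ^+ 2 *
         semigroup p (t - s) (fun z => sigma z ^+ 2) z) z0 -
      semigroup p t (fun z => sigma z ^+ 2) z0 *
      semigroup p s (fun z => sigma z ^+ 2) z0)%R) mh h_ge0 hC hN.
rewrite inth intg -(fineK EV_fin) -(fineK EV2_fin).
set c := Rintegral _ _ _ => H.
have {}H : (2 * c)%:E = (T ^+ 2)%:E * (fine 'E_Pr[V ^+ 2])%:E -
    T%:E * (fine 'E_Pr[V])%:E * (T%:E * (fine 'E_Pr[V])%:E).
  apply: H => //.
  - by rewrite -EFinM ltry.
  - by move=> z; exact: mule_ge0.
  - by move=> s t; rewrite /g muleC.
  - by move=> t s tT; rewrite /g /= mN// mul0e.
  - by rewrite -!EFinM ltry.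
  - move=> t s s0 st tT hfin gfin.
    rewrite semigroup_product// !semigroup_mean ?fine_mul//.
      by rewrite s0 (le_trans st).
    by rewrite tT (le_trans s0).
rewrite -EFin_expe -EFinB; congr EFin.
move: H; rewrite -!EFinM -EFinB => -[H].
rewrite mulrAC H; field.
by rewrite gt_eqF.
Qed.

End realized_variance_moments.

(** * Second-order expansion of the square root at the mean *)

Section square_root_expansion.
Set Implicit Arguments.
Context {d : measure_display} {Omega : measurableType d} {R : realType}.

Lemma sqrt_derive1n2 (m : R) : 0 < m ->
  (@Num.sqrt R)^`(2)%classic m = - (4 * (m * Num.sqrt m))^-1.
Proof.
move=> m0; rewrite derive1nS derive1E.
(* The formula for the first derivative is available at positive points, hence on a neighbourhood of
   [m], which suffices for differentiating once more. *)
rewrite (@near_eq_derive _ _ _ _ (fun x => (2 * Num.sqrt x)^-1)); last first.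
  near=> x; rewrite derive1n1 derive1E derive_sqrt//.
  near: x; exact: lt_nbhsr.
have s0 : Num.sqrt m != 0 by rewrite gt_eqF// sqrtr_gt0.
have ds : is_derive m 1 (fun x => 2 * Num.sqrt x) (2 * (2 * Num.sqrt m)^-1).
  have := is_deriveZ 2 (is_derive1_sqrt m0).
  by [].
rewrite deriveV ?mulf_neq0// derive_val.
rewrite /GRing.scale /= -[X in 4 * (X * _)](sqr_sqrtr (ltW m0)).
by field.
Unshelve. all: by end_near. Qed.

Lemma powR32 (m : R) : 0 < m -> m `^ (3 / 2) = m * Num.sqrt m.
Proof.
move=> m0; rewrite (_ : 3 / 2 = 1 + 2^-1); last by field.
by rewrite powRD ?(gt_eqF m0) ?implybT// powRr1 ?ltW// powR12_sqrt// ltW.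
Qed.

Variables (Pr : probability Omega R) (V : Omega -> R).
Hypotheses (iV : Pr.-integrable setT (EFin \o V))
  (iV2 : Pr.-integrable setT (fun w => (V w ^+ 2)%:E)).

Lemma expectation_quadratic (A B C : R) :
  'E_Pr[(fun w => A + B * V w + C * V w ^+ 2)%R]%E =
  (A + B * fine 'E_Pr[V] + C * fine 'E_Pr[V ^+ 2]%E)%:E.
Proof.
rewrite unlock.
have iA : Pr.-integrable setT (cst A%:E).
  exact: finite_measure_integrable_cst.
have iB : Pr.-integrable setT (fun w => B%:E * (V w)%:E)%E.
  exact: integrableZl.
have iC : Pr.-integrable setT (fun w => C%:E * (V w ^+ 2)%:E)%E.
  by exact: integrableZl.
transitivity (\int[Pr]_w (A%:E + B%:E * (V w)%:E + C%:E * (V w ^+ 2)%:E))%E.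
  by apply: eq_integral => w _; rewrite !EFinD !EFinM.
rewrite integralD//; last exact: integrableD.
rewrite integralD// !integralZl//.
rewrite integral_probability_cst.
rewrite !EFinD !EFinM !fineK//; exact: integrable_fin_num.
Qed.

Lemma variance_finE :
  'V_Pr[V]%E = (fine 'E_Pr[V ^+ 2]%E - (fine 'E_Pr[V]%E) ^+ 2)%:E.
Proof.
rewrite /variance unlock.
set m := fine _.
rewrite (_ : _ * _ = fun w => m ^+ 2 + (- 2 * m) * V w + 1 * V w ^+ 2);
    last first.
  apply/funext => w; transitivity ((V w - m) * (V w - m)) => //; ring.
by rewrite expectation_quadratic -/m; congr EFin; ring.
Qed.

(** Around the mean the linear term has expectation 0, and the quadratic one contributes half the
    second derivative times the variance; the factor 8 is 2 times 4. *)
Lemma taylor2_mean_sqrtE : (0 < 'E_Pr[V])%E ->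
  let m := fine 'E_Pr[V]%E in
  taylor2_mean_sqrt Pr V =
  (Num.sqrt m - fine 'V_Pr[V]%E / (8 * m `^ (3 / 2)))%:E.
Proof.
move=> V0 m.
have m0 : 0 < m.
  apply: fine_gt0; rewrite V0/=.
  by rewrite ltey_eq unlock integrable_fin_num.
have s0 : Num.sqrt m != 0 by rewrite gt_eqF// sqrtr_gt0.
rewrite /taylor2_mean_sqrt -/m.
set q := (X in expectation _ X).
(* [c1] and [c2] are the Taylor coefficients of orders 1 and 2; the polynomial is re-expanded in
   powers of [V w] to fit [expectation_quadratic]. *)
pose c1 : R := (2 * Num.sqrt m)^-1.
pose c2 : R := - (4 * (m * Num.sqrt m))^-1 / 2.
rewrite (_ : q = fun w => (Num.sqrt m - c1 * m + c2 * m ^+ 2) +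
    (c1 - 2 * c2 * m) * V w + c2 * V w ^+ 2); last first.
  apply/funext => w; rewrite /q !big_ord_recr big_ord0 /= add0r.
  have d2 : (@Num.sqrt R)^`()^`()%classic m = _ := sqrt_derive1n2 _ m0.
  rewrite d2 derive1E derive_sqrt//.
  rewrite /c1 /c2 !factS fact0; field.
  by rewrite s0 gt_eqF.
rewrite expectation_quadratic variance_finE -/m powR32//; congr EFin.
rewrite /c1 /c2 /=; field.
by rewrite s0 gt_eqF.
Qed.

(** The bound of the square root by [1 + V w] makes it integrable, so the expectation splits and
    [fine] is faithful. *)
Lemma expectation_sqrtB (c K : R) : (forall w, 0 <= V w) ->
  'E_Pr[(fun w => c * (Num.sqrt (V w) - K))%R]%E =
  (c * (fine 'E_Pr[fun w => Num.sqrt (V w)]%E - K))%:E.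
Proof.
move=> V0.
have iS : Pr.-integrable setT (fun w => (Num.sqrt (V w))%:E).
  have i1 : Pr.-integrable setT (fun w => (1 + V w)%:E).
    under eq_fun do rewrite EFinD; apply: integrableD => //.
    exact: finite_measure_integrable_cst.
  apply: le_integrable i1 => //.
    have /measurable_EFinP mV := measurable_int _ iV.
    have msqrt := continuous_measurable_fun (@sqrt_continuous R).
    by apply/measurable_EFinP; exact: measurableT_comp msqrt mV.
  move=> w _; rewrite /= lee_fin ger0_norm ?sqrtr_ge0// ger0_norm ?addr_ge0//.
  rewrite -{2}(sqr_sqrtr (V0 w)); have := sqrtr_ge0 (V w); nra.
rewrite unlock.
have iK : Pr.-integrable setT (cst K%:E).
  exact: finite_measure_integrable_cst.
transitivity (c%:E * \int[Pr]_w ((Num.sqrt (V w))%:E - K%:E))%E.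
  by rewrite -integralZl//; exact: integrableB.
rewrite integralB//= integral_probability_cst.
by rewrite EFinM EFinB fineK// integrable_fin_num.
Qed.

End square_root_expansion.

Theorem theorem2 (R : realType) (dO dX : measure_display)
  (Omega : measurableType dO) (X : measurableType dX)
  (Pr : probability Omega R)
  (P : R.-pker X ~> X) (G g : X -> R -> R)
  (hG : is_sojourn_law G g)
  (xn : nat -> Omega -> X) (tau : nat -> Omega -> R)
  (hren : is_markov_renewal Pr P G xn tau)
  (p : R -> R.-pker (X * R)%type ~> (X * R)%type)
  (hQ : generates (generator P G g) p)
  (hmarkov : is_markov_process Pr (semi_markov xn tau) p)
  (x : X) (hstart : {ae Pr, forall w, semi_markov xn tau 0 w = (x, 0)})
  (r T K : R) (hT : 0 < T) (sigma : X * R -> R)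
  (hsigma : admissible_volatility Pr sigma (semi_markov xn tau) T) :
  let V := realized_variance sigma (semi_markov xn tau) T in
  let sigma2 : X * R -> R := fun z => sigma z ^+ 2 in
  let expQ := semigroup p in
  let EV := fine 'E_Pr[V] in
  let VarV := fine 'V_Pr[V] in
  let m := T^-1 * \int[lebesgue_measure]_(t in `[0%R, T])
                    expQ t sigma2 (x, 0) in
  [/\ volswap_value Pr r T K V =
        (expR (- (r * T)) *
          (fine 'E_Pr[fun w => Num.sqrt (V w)] - K))%:E,
      taylor2_mean_sqrt Pr V =
        (Num.sqrt EV - VarV / (8 * EV `^ (3 / 2)))%:E,
      expR (- (r * T)) * (Num.sqrt m - VarV / (8 * m `^ (3 / 2)) - K) =
        expR (- (r * T)) * (Num.sqrt EV - VarV / (8 * EV `^ (3 / 2)) - K) &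
      'V_Pr[V] =
        (2 / T ^+ 2 *
         \int[lebesgue_measure]_(t in `[0%R, T])
           \int[lebesgue_measure]_(s in `[0%R, t])
             (expQ s (fun z => (sigma2 z * expQ (t - s) sigma2 z)%R) (x, 0)
              - expQ t sigma2 (x, 0) * expQ s sigma2 (x, 0)))%:E].
Proof.
move=> V sigma2 expQ EV VarV m.
have mZ := measurable_semi_markov _ _ (renewal_measurable_state hren)
  (renewal_measurable_time hren).
have iV := integrable_realized_variance mZ hT hsigma.
have iV2 := volatility_L2 hsigma.
(* With this exact identity the two closed forms of the approximate price coincide by
   substitution. *)
have mE : m = EV := mean_realized_varianceE mZ hmarkov hstart hT hsigma.
split.
- by apply: expectation_sqrtB => // w; exact: realized_variance_ge0.
- by apply: taylor2_mean_sqrtE => //; exact: volatility_gt0 hsigma.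
- by rewrite mE.
- rewrite variance_finE//.
  rewrite -(variance_realized_varianceE mZ hmarkov hstart hT hsigma).
  by rewrite EFinB EFin_expe !fineK// unlock; exact: integrable_fin_num.
Qed.
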